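(* Consider the quantized estimation system below under the identical-models assumption, with sensors grouped into groups $\mathcal{G}_p$ ($p=1,\dots,P$, $P<N$) having identical observation statistical models $(\hat{\mathscr{X}}_p,\hat{\mathscr{F}}_p,\hat{\mathscr{P}}_p^{\boldsymbol{\theta}})$, and each $\mathcal{G}_p$ split into $M_p$ disjoint nonempty subgroups $\mathcal{G}_p^{(m)}$ whose sensors all use the same superquantizer $\hat\Gamma_p^{(m)}=[\hat\gamma_{p1}^{(m)},\dots,\hat\gamma_{pL_p^{(m)}}^{(m)}]^T$, where $\hat\gamma_{pl}^{(m)}$ has $\hat R_{pl}^{(m)}$ levels and quantization regions $\{\hat I_{mpl}^{(r)}\}$. (i) Suppose the interior of $\boldsymbol{\Theta}\subset\mathbb{R}^{D_{\boldsymbol{\theta}}}$ is nonempty and every $q_j^{(\mathbf{s})}(\boldsymbol{\theta})$ is twice differentiable in $\boldsymbol{\theta}$ on $\boldsymbol{\Theta}$. Then for any $\boldsymbol{\theta}$, any quantization regions $\{\hat I_{mpl}^{(r)}\}$ and any statistical models $\{(\hat{\mathscr{X}}_p,\hat{\mathscr{F}}_p,\hat{\mathscr{P}}_p^{\boldsymbol{\theta}})\}$, if $$D_{\boldsymbol{\theta}} > \lambda_{\text{ISM}}\big(\{\mathcal{G}_p^{(m)}\},\{\hat R_{pl}^{(m)}\}\big) := \sum_{p=1}^P\sum_{m=1}^{M_p}\Big(\prod_{l=1}^{L_p^{(m)}}\hat R_{pl}^{(m)}-1\Big),$$ then the Fisher information matrix for estimating $\boldsymbol{\theta}$ is singular.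 (ii) Suppose the interior of $\boldsymbol{\Theta}$ is nonempty and every $q_j^{(\mathbf{s})}(\boldsymbol{\theta})$ is continuous in $\boldsymbol{\theta}$. Then for any $\{\hat I_{mpl}^{(r)}\}$ and any $\{(\hat{\mathscr{X}}_p,\hat{\mathscr{F}}_p,\hat{\mathscr{P}}_p^{\boldsymbol{\theta}})\}$, if the same inequality $D_{\boldsymbol{\theta}} > \lambda_{\text{ISM}}$ holds, the vector parameter space $\boldsymbol{\Theta}$ is not identifiable; moreover, every open subset $\mathcal{U}\subset\boldsymbol{\Theta}$ of $\mathbb{R}^{D_{\boldsymbol{\theta}}}$ contains infinitely many nonidentifiable vector parameter points.
   Context: System: $N$ sensors; sensor $j$ observes $\mathbf{x}_j$ with statistical model $(\mathscr{X}_j,\mathscr{F}_j,\mathscr{P}_j^{\boldsymbol{\theta}})$, the $\mathbf{x}_j$ independent across $j$, with unknown $\boldsymbol{\theta}\in\boldsymbol{\Theta}\subset\mathbb{R}^{D_{\boldsymbol{\theta}}}$. $\mathbf{x}_j$ is partitioned into $L_j$ subvectors $\mathbf{x}_{jl}$, each quantized by an $R_{jl}$-level vector quantizer $\gamma_{jl}(\mathbf{x}_{jl})=\sum_r r\,\mathbb{1}\{\mathbf{x}_{jl}\in I_{jl}^{(r)}\}$ with disjoint regions covering the domain; the superquantizer output $\mathbf{u}_j=\Gamma_j(\mathbf{x}_j)=[\gamma_{j1}(\mathbf{x}_{j1}),\dots,\gamma_{jL_j}(\mathbf{x}_{jL_j})]^T$ is sent error-free to a fusion center, which estimates $\boldsymbol{\theta}$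 from $\mathbf{u}=[\mathbf{u}_1^T,\dots,\mathbf{u}_N^T]^T$. Define $q_j^{(\mathbf{s})}(\boldsymbol{\theta})=\mathscr{P}_j^{\boldsymbol{\theta}}(\Gamma_j(\mathbf{x}_j)=\mathbf{s})$ for each possible outcome $\mathbf{s}$ of $\Gamma_j$; the Fisher information matrix is $\mathbf{J}(\boldsymbol{\theta})=\sum_j\sum_{\mathbf{s}}\frac{1}{q_j^{(\mathbf{s})}}\frac{\partial q_j^{(\mathbf{s})}}{\partial\boldsymbol{\theta}}\big[\frac{\partial q_j^{(\mathbf{s})}}{\partial\boldsymbol{\theta}}\big]^T$. Two distinct points $\boldsymbol{\theta},\boldsymbol{\theta}'$ are observationally equivalent if $\Pr(\mathbf{u}|\boldsymbol{\theta})=\Pr(\mathbf{u}|\boldsymbol{\theta}')$ for all $\mathbf{u}$; a point is identifiable if no other point of $\boldsymbol{\Theta}$ is observationally equivalent to it; $\boldsymbol{\Theta}$ is identifiable if every point is. Identical-models assumption: the statistical models of the observation vectors at some different sensors are known to be the same for all $\boldsymbol{\theta}$, so there are only $P<N$ distinct models. Hence for $j,j'\in\mathcal{G}_p^{(m)}$, $q_j^{(\mathbf{s})}(\boldsymbol{\theta})=q_{j'}^{(\mathbf{s})}(\boldsymbol{\theta})$. *)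

(* Defs.v *)
From HB Require Import structures.
From mathcomp Require Import all_boot all_order all_algebra.
From mathcomp Require Import all_classical all_reals all_analysis.
Set Implicit Arguments. Unset Strict Implicit. Unset Printing Implicit Defensive.
Import Order.TTheory GRing.Theory Num.Theory.
Import numFieldNormedType.Exports.
Local Open Scope ring_scope.
Local Open Scope classical_set_scope.

(* Indexing conventions:
   - sensors j : 'I_N ; groups p : 'I_P ; subgroups k : 'I_K (all subgroups
     of all groups, enumerated globally); grpOf k is the group containing the
     subgroup k; sg j is the subgroup of sensor j (so groups/subgroups are
     disjoint by construction).
   - subgroup k uses the superquantizer with L k component quantizers, the
     l-th having Rq k l levels (levels labelled 0..Rq k l - 1).
   - X p : observation space of group p, Pm p th its probability law. *)

Section Model.
Variables (R : realType) (D N P K : nat).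
Variables (grpOf : 'I_K -> 'I_P) (sg : 'I_N -> 'I_K).
Variables (L : 'I_K -> nat) (Rq : forall k, 'I_(L k) -> nat).
Variables (d : 'I_P -> measure_display) (X : forall p, measurableType (d p)).
Variable (Pm : forall p, 'rV[R]_D -> probability (X p) R).
Variable (gam : forall k (l : 'I_(L k)), X (grpOf k) -> 'I_(@Rq k l)).

Definition outcome (k : 'I_K) : finType := {dffun forall l : 'I_(L k), 'I_(@Rq k l)}.

Definition superq (k : 'I_K) (x : X (grpOf k)) : outcome k :=
  @finfun _ (fun l : 'I_(L k) => 'I_(@Rq k l)) (fun l => @gam k l x).

Definition qprob (k : 'I_K) (s : outcome k) (th : 'rV[R]_D) : R :=
  fine (Pm (grpOf k) th [set x | superq x = s]).

Definition qsens (j : 'I_N) (s : outcome (sg j)) : 'rV[R]_D -> R := qprob s.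

Definition ebasis (a : 'I_D) : 'rV[R]_D := delta_mx 0 a.

Definition grad (f : 'rV[R]_D -> R) (th : 'rV[R]_D) : 'rV[R]_D :=
  \row_a derive f th (ebasis a).

(* Fisher information matrix; terms with q = 0 are omitted (0/0 convention) *)
Definition FIM (th : 'rV[R]_D) : 'M[R]_D :=
  \sum_(j < N) \sum_(s : outcome (sg j) | qsens s th != 0)
     (qsens s th)^-1 *: ((grad (qsens s) th)^T *m grad (qsens s) th).

(* joint pmf of u = [u_1;...;u_N] (independent sensors) *)
Definition jointpmf (u : {dffun forall j : 'I_N, outcome (sg j)}) (th : 'rV[R]_D) : R :=
  \prod_(j < N) qsens (u j) th.

Definition obs_equiv (th th' : 'rV[R]_D) : Prop :=
  forall u, jointpmf u th = jointpmf u th'.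

Definition identifiable_pt (Theta : set 'rV[R]_D) (th : 'rV[R]_D) : Prop :=
  forall th', Theta th' -> th' <> th -> ~ obs_equiv th th'.

Definition identifiable (Theta : set 'rV[R]_D) : Prop :=
  forall th, Theta th -> identifiable_pt Theta th.

End Model.

Definition lambda_ISM (K : nat) (L : 'I_K -> nat) (Rq : forall k, 'I_(L k) -> nat) : nat :=
  (\sum_(k < K) ((\prod_(l < L k) Rq k l) - 1))%N.

(* Main.v *)
Require Import Defs.
From HB Require Import structures.
From mathcomp Require Import all_boot all_order all_algebra.
From mathcomp Require Import all_classical all_reals all_analysis.
From mathcomp Require Import ring lra zify.
Set Implicit Arguments. Unset Strict Implicit. Unset Printing Implicit Defensive.
Import Order.TTheory GRing.Theory Num.Theory.
Import numFieldNormedType.Exports.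
Local Open Scope ring_scope.

(** For each subgroup the outcome probabilities sum to 1, so dropping one
    outcome per subgroup leaves [lambda_ISM] functions of theta that determine
    all the others.
    (i) The gradients of these functions span a space of dimension less than D,
    and a vector orthogonal to all of them is in the kernel of the Fisher matrix.
    (ii) These functions form a continuous map from an open subset of R^D to
    R^m with m < D, and no such map is injective.  Indeed R^m can be coloured
    with m + 1 <= D colours so that the pieces of each colour class are small and
    uniformly separated.  Were the map injective on a cube, no pulled-back piece
    would meet two opposite faces of the cube; the pieces of colour i would then
    separate the two i-th faces, contradicting the Poincare-Miranda theorem.  The
    latter is proved on a grid, by integrating mod 2 a cup product of
    coboundaries over the grid and applying Stokes' formula. *)

(** * Discrete Poincare-Miranda theorem *)

(** Grid points are total functions on [nat], so boxes of every dimension share one type; directions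
    outside the active list act as frozen parameters. *)
Definition upd (x : nat -> nat) (i c : nat) : nat -> nat :=
  fun j => if j == i then c else x j.

Definition step (x : nat -> nat) (i : nat) : nat -> nat := upd x i (x i).+1.

Definition fdiff (i : nat) (h : (nat -> nat) -> 'F_2) (x : nat -> nat) : 'F_2 :=
  h (step x i) + h x.

Definition without (i : nat) (s : seq nat) := [seq j <- s | j != i].

Arguments without : simpl never.

(** Cup product of the coboundaries of [gs] on the cube with lowest corner [x] and directions [s]: a
    sum over monotone edge paths, one factor per edge, with signs vanishing mod 2. *)
Fixpoint cup (gs : seq ((nat -> nat) -> 'F_2)) (s : seq nat) (x : nat -> nat) : 'F_2 :=
  if gs is g :: gs' then
    \sum_(i <- s) fdiff i g x * cup gs' (without i s) (step x i)
  else 1.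

Fixpoint boxsum (n : nat) (s : seq nat) (h : (nat -> nat) -> 'F_2) (x : nat -> nat) : 'F_2 :=
  if s is i :: s' then \sum_(c < n) boxsum n s' h (upd x i c) else h x.

Lemma addFF2 (a : 'F_2) : a + a = 0.
Proof. by rewrite addrr_pchar2 // pchar_Fp. Qed.

Lemma subFF2 (a b : 'F_2) : a - b = a + b.
Proof. by apply/eqP; rewrite subr_eq -addrA addFF2 addr0. Qed.

Lemma updC x i c j e : i != j -> upd (upd x i c) j e = upd (upd x j e) i c.
Proof.
move=> ij; apply/funext => k; rewrite /upd.
by case: (eqVneq k j) => // ->; rewrite eq_sym (negbTE ij).
Qed.

Lemma upd_upd x i c e : upd (upd x i c) i e = upd x i e.
Proof. by apply/funext => k; rewrite /upd; case: eqP. Qed.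

Lemma upd_same x i c : upd x i c i = c.
Proof. by rewrite /upd eqxx. Qed.

Lemma upd_other x i c j : j != i -> upd x i c j = x j.
Proof. by rewrite /upd => /negbTE ->. Qed.

Lemma stepC x i j : step (step x i) j = step (step x j) i.
Proof.
case: (eqVneq i j) => [-> //|ij]; rewrite /step updC// !upd_other //.
by rewrite eq_sym.
Qed.

Lemma withoutC i j s : without i (without j s) = without j (without i s).
Proof. by rewrite /without -!filter_predI; apply: eq_filter => k /=; rewrite andbC. Qed.

Lemma without_notin i s : i \notin s -> without i s = s.
Proof. by move=> h; apply/all_filterP/allP => j js; apply: contraNneq h => <-. Qed.

Lemma without_cons i j s :
  without i (j :: s) = if j == i then without i s else j :: without i s.
Proof. by rewrite /without /=; case: eqP. Qed.

Lemma mem_without i s j : (j \in without i s) = (j != i) && (j \in s).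
Proof. by rewrite mem_filter. Qed.

Lemma fdiffM i (f h : (nat -> nat) -> 'F_2) x :
  fdiff i (fun y => f y * h y) x = fdiff i f x * h (step x i) + f x * fdiff i h x.
Proof.
by rewrite /fdiff -[LHS]addr0 -(addFF2 (f x * h (step x i))); ring.
Qed.

Lemma sum_sym0 (s : seq nat) (F : nat -> nat -> 'F_2) :
  (forall i j, F i j = F j i) -> \sum_(i <- s) \sum_(j <- without i s) F i j = 0.
Proof.
move=> Fsym; under eq_bigr => i _ do rewrite big_filter (bigID (fun j => (j < i)%N)) /=.
rewrite big_split /=.
set A := (X in X + _); set B := (X in _ + X); suff -> : A = B by exact: addFF2.
rewrite /A /B (exchange_big_dep xpredT) //=; apply: eq_bigr => i _.
rewrite (eq_bigr (fun k => F i k)); last by move=> *; rewrite Fsym.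
by apply: eq_bigl => j; rewrite eq_sym -leqNgt ltn_neqAle eq_sym; case: eqVneq.
Qed.

Lemma fdiff_sum (I : Type) (r : seq I) i (F : I -> (nat -> nat) -> 'F_2) x :
  fdiff i (fun y => \sum_(j <- r) F j y) x = \sum_(j <- r) fdiff i (F j) x.
Proof. by rewrite /fdiff -big_split. Qed.

(* Closedness of a cup product of coboundaries; the cross terms are symmetric
   in the two directions involved and cancel because 2 = 0. *)
Lemma cup_closed gs s x : size s = (size gs).+1 -> uniq s ->
  \sum_(i <- s) fdiff i (cup gs (without i s)) x = 0.
Proof.
elim: gs s x => [|g gs IH] s x ss us.
  by rewrite big1 // => i _; rewrite /fdiff /= addFF2.
under eq_bigr => i _.
  rewrite /= fdiff_sum.
  under eq_bigr => j _.
    rewrite (fdiffM i (fdiff j g) (fun y => cup gs (without j (without i s)) (step y j))).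
    over.
  rewrite big_split /=; over.
rewrite big_split /= sum_sym0 ?add0r; last first.
  by move=> i j; rewrite /fdiff withoutC (stepC _ i j); ring.
under eq_bigr do rewrite big_filter.
rewrite (exchange_big_dep xpredT) //= big_seq big1 // => j js.
transitivity (fdiff j g x * \sum_(i <- without j s) fdiff i (cup gs (without i (without j s))) (step x j)).
  rewrite mulr_sumr big_filter; apply: eq_big => [i|i ij]; first by rewrite eq_sym.
  by rewrite /fdiff /= withoutC (stepC x).
rewrite IH ?mulr0 ?filter_uniq //.
have := rem_filter j us; rewrite /without => <-.
by rewrite size_rem // ss.
Qed.

(** By the Leibniz rule [fdiffM], the terms that differentiate the second factor add up to [g x]
    times the sum in [cup_closed], which is zero. *)
Lemma cup_divergence g gs s x : size s = (size gs).+1 -> uniq s ->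
  cup (g :: gs) s x = \sum_(i <- s) fdiff i (fun y => g y * cup gs (without i s) y) x.
Proof.
move=> ss us; under [RHS]eq_bigr do rewrite fdiffM.
by rewrite big_split /= -mulr_sumr cup_closed // mulr0 addr0.
Qed.

Lemma boxsum_sum n (I : Type) (r : seq I) s (F : I -> (nat -> nat) -> 'F_2) x :
  boxsum n s (fun y => \sum_(j <- r) F j y) x = \sum_(j <- r) boxsum n s (F j) x.
Proof.
elim: s x => //= i s IH x; rewrite exchange_big /=.
by apply: eq_bigr => c _; rewrite IH.
Qed.

Lemma eq_boxsum n s (h h' : (nat -> nat) -> 'F_2) x :
  (forall y, (forall j, j \notin s -> y j = x j) -> h y = h' y) ->
  boxsum n s h x = boxsum n s h' x.
Proof.
elim: s x => /= [x -> //|i s IH x hh].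
apply: eq_bigr => c _; apply: IH => y hy; apply: hh => j.
by rewrite inE negb_or => /andP[ji js]; rewrite hy // upd_other.
Qed.

Lemma boxsum_fdiff_out n s i h x : i \notin s ->
  boxsum n s (fdiff i h) x = boxsum n s h (step x i) + boxsum n s h x.
Proof.
elim: s x => //= j s IH x; rewrite inE negb_or => /andP[ij js].
rewrite -big_split; apply: eq_bigr => c _; rewrite IH //.
by rewrite /step (upd_other _ _ ij) updC // eq_sym.
Qed.

(** Discrete Stokes formula: along direction [i] the sum telescopes to two opposite faces. *)
Lemma boxsum_fdiff n s i h x : uniq s -> i \in s ->
  boxsum n s (fdiff i h) x =
  boxsum n (without i s) h (upd x i n) + boxsum n (without i s) h (upd x i 0).
Proof.
elim: s x => //= j s IH x /andP[js us]; rewrite inE without_cons.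
case: (eqVneq j i) => [ji _|ij /=]; last first.
  move=> si; rewrite -big_split; apply: eq_bigr => c _.
  by rewrite IH //= !(updC x _ _ ij).
rewrite {}ji in js *; rewrite without_notin //.
rewrite (eq_bigr (fun c : 'I_n => boxsum n s h (upd x i c.+1) - boxsum n s h (upd x i c))).
  rewrite -(big_mkord xpredT (fun c => boxsum n s h (upd x i c.+1) - boxsum n s h (upd x i c))).
  by rewrite telescope_sumr // subFF2.
move=> c _; rewrite boxsum_fdiff_out // /step upd_upd upd_same.
by rewrite subFF2.
Qed.

(* A factor that is constant along every remaining direction kills the product. *)
Lemma cup_map_eq0 (a : nat -> (nat -> nat) -> 'F_2) j c s u x :
  (forall y z, y j = c -> z j = c -> a j y = a j z) ->
  j \in s -> j \notin u -> x j = c -> cup (map a s) u x = 0.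
Proof.
move=> aj; elim: s u x => //= k s IH u x; rewrite inE => js ju xj.
rewrite big_seq big1 // => i iu.
have ji : j != i by apply: contraNneq ju => ->.
have sj : step x i j = c by rewrite /step upd_other.
move: js; case: (eqVneq j k) => [<- _|_ /= js].
  by rewrite /fdiff (aj _ _ sj xj) addFF2 mul0r.
by rewrite IH ?mulr0 // mem_without (negbTE ju) andbF.
Qed.

Lemma boxsum0 n s x : boxsum n s (fun=> 0) x = 0.
Proof. by elim: s x => //= i s IH x; rewrite big1. Qed.

(** Induction on the dimension by Stokes. With [i] the head of the list, the [j]-faces for other [j]
    contribute nothing since [a j] is constant there, the low [i]-face nothing since [a i] is 0, and
    on the high [i]-face [a i] is 1, which leaves the lower-dimensional sum. *)
Lemma boxsum_cup n (a : nat -> (nat -> nat) -> 'F_2) s x : uniq s ->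
  (forall i y, i \in s -> y i = 0%N -> a i y = 0) ->
  (forall i y, i \in s -> y i = n -> a i y = 1) ->
  boxsum n s (cup (map a s) s) x = 1.
Proof.
elim: s x => [//|i s IH x] uis a0 a1.
have /andP[iNs us] : (i \notin s) && uniq s := uis.
transitivity (boxsum n (i :: s) (fun y => \sum_(j <- i :: s)
    fdiff j (fun z => a i z * cup (map a s) (without j (i :: s)) z) y) x).
  by apply: eq_boxsum => y _; rewrite -cup_divergence //= size_map.
rewrite boxsum_sum big_cons [X in _ + X]big_seq [X in _ + X]big1 ?addr0; last first.
  move=> j js; have ji : j != i by apply: contraTneq js => ->.
  have cup0 c y : (c = 0%N \/ c = n) -> y j = c ->
      cup (map a s) (without j (i :: s)) y = 0.
    move=> cn yj; apply: (@cup_map_eq0 a j c) => //.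
      have js' : j \in i :: s by rewrite inE js orbT.
      by case: cn => -> z t zj tj; rewrite ?(a0 _ _ js' zj, a0 _ _ js' tj) // ?(a1 _ _ js' zj, a1 _ _ js' tj).
    by rewrite mem_without eqxx.
  rewrite boxsum_fdiff // ?inE ?js ?orbT //.
  by rewrite -(boxsum0 n (without j (i :: s)) (upd x j n)) -[X in _ = X]addr0
    -{2}(boxsum0 n (without j (i :: s)) (upd x j 0)); congr (_ + _);
    apply: eq_boxsum => y /(_ j); rewrite mem_without eqxx upd_same => /(_ isT) yj;
    rewrite (cup0 _ _ _ yj) ?mulr0 //; [right|left].
rewrite boxsum_fdiff ?mem_head //.
have -> : without i (i :: s) = s by rewrite without_cons eqxx without_notin.
rewrite -[RHS]addr0 -[in RHS](boxsum0 n s (upd x i 0)); congr (_ + _); last first.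
  apply: eq_boxsum => y /(_ i iNs); rewrite upd_same => yi.
  by rewrite a0 ?mem_head // mul0r.
rewrite -[RHS](IH (upd x i n) us).
- apply: eq_boxsum => y /(_ i iNs); rewrite upd_same => yi.
  by rewrite a1 ?mem_head // mul1r.
- by move=> j y js; apply: a0; rewrite inE js orbT.
- by move=> j y js; apply: a1; rewrite inE js orbT.
Qed.

Lemma boxsum_neq0 n s h x : uniq s -> boxsum n s h x != 0 ->
  exists y, [/\ forall j, j \in s -> (y j < n)%N,
    forall j, j \notin s -> y j = x j & h y != 0].
Proof.
elim: s x => [x _ hx|i s IH x /= /andP[iNs us] hx]; first by exists x.
have [c] : exists c : 'I_n, boxsum n s h (upd x i c) != 0.
  apply/existsP; apply: contraNT hx => /existsPn hx.
  by rewrite big1 // => c _; apply/eqP/negbNE/hx.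
case/(IH _ us) => y [ys yout hy]; exists y; split=> // j; rewrite inE.
  by case: eqVneq => [-> _|_ /ys //]; rewrite yout // upd_same.
by rewrite negb_or => /andP[ji js]; rewrite yout // upd_other.
Qed.

(** Some edge path from [x] has all factors nonzero, and the edge of factor [k] joins points where
    [a k] differs. The path uses each direction of [u] at most once, so it stays in the unit cube at
    [x]. *)
Lemma cup_neq0 (a : nat -> (nat -> nat) -> 'F_2) s u x :
  cup (map a s) u x != 0 -> forall k, k \in s -> exists y z,
  [/\ forall j, (x j <= y j <= x j + (j \in u))%N,
      forall j, (x j <= z j <= x j + (j \in u))%N & a k y != a k z].
Proof.
elim: s u x => //= i s IH u x hx k.
have /hasP[j ju hj] : has (fun j => fdiff j (a i) x *
    cup (map a s) (without j u) (step x j) != 0) u.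
  apply: contraNT hx => /hasPn hx.
  by rewrite big_seq big1 // => j /hx; rewrite negbK => /eqP.
have [aj cj] : a i (step x j) != a i x /\ cup (map a s) (without j u) (step x j) != 0.
  move: hj; rewrite mulf_eq0 negb_or => /andP[fj ->]; split=> //.
  by apply: contraNneq fj => aj; rewrite /fdiff aj addFF2.
have stepx l : step x j l = (x l + (l == j))%N.
  by rewrite /step /upd; case: eqVneq => [->|]; lia.
rewrite inE; case: eqVneq => [-> _|_ /= ks].
  exists (step x j), x; split=> // l; rewrite ?stepx; last by lia.
  by case: (eqVneq l j) => [->|]; rewrite ?ju; lia.
have [y [z [hy hz ayz]]] := IH _ _ cj _ ks; exists y, z.
by split=> // l; [move: (hy l)|move: (hz l)]; rewrite stepx mem_without;
  case: (eqVneq l j) => [->|] /=; rewrite ?ju; lia.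
Qed.

(** The mod 2 integral equals 1, so some cell carries a nonzero product, and every [a i] changes on
    it. *)
Lemma discrete_miranda (n D : nat) (a : nat -> (nat -> nat) -> bool) :
  (forall i y, (i < D)%N -> y i = 0%N -> a i y = false) ->
  (forall i y, (i < D)%N -> y i = n -> a i y = true) ->
  exists2 x : nat -> nat, (forall i, (i < D)%N -> (x i < n)%N) &
    forall i, (i < D)%N -> exists y z,
    [/\ forall j, (x j <= y j <= (x j).+1)%N,
        forall j, (x j <= z j <= (x j).+1)%N & a i y != a i z].
Proof.
move=> a0 a1; pose b i y : 'F_2 := (a i y)%:R.
have [|x [xn _ /cup_neq0 xP]] :=
  @boxsum_neq0 n (iota 0 D) (cup (map b (iota 0 D)) (iota 0 D)) (fun=> 0%N) (iota_uniq _ _).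
  rewrite boxsum_cup ?iota_uniq ?oner_neq0 // => i y; rewrite mem_iota /= /b => iD yi.
    by rewrite a0.
  by rewrite a1.
exists x => [i iD|i iD]; first by apply: xn; rewrite mem_iota.
have [|y [z [hy hz hb]]] := xP i; first by rewrite mem_iota.
exists y, z; split; last by apply: contraNneq hb; rewrite /b => ->.
- by move=> j; move: (hy j); case: (_ \in _); lia.
- by move=> j; move: (hz j); case: (_ \in _); lia.
Qed.

(** * Small separated colour classes in R^m *)

Section Colouring.
Variables (R : realType) (T : finType).

(** [#|T|.+2] times [eta] is one half, so thresholds up to [#|T|.+1] times [eta] keep the nearest
    integer unambiguous. *)
Definition eta : R := (2 * #|T|.+2%:R)^-1.

Definition rnd (r : R) : int := Num.floor (r + 2^-1).

Definition nearset (c : nat) (y : T -> R) : {set T} :=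
  [set l | `|y l - (rnd (y l))%:~R| <= c%:R * eta].

(* The thresholds increase with [c], so by maximality no further coordinate of
   a point of colour [c] is even within [c.+1%:R * eta] of an integer. *)
Definition colour (y : T -> R) : 'I_#|T|.+1 :=
  [arg max_(c > ord0 | (c <= #|nearset c y|)%N) (c : nat)].

(** Label of the piece of the colour class that contains [y]: a near coordinate is pinned to its
    integer, any other one to a unit interval. *)
Definition key (y : T -> R) (l : T) : bool * int :=
  if l \in nearset (colour y) y then (true, rnd (y l)) else (false, Num.floor (y l)).

Lemma eta_gt0 : 0 < eta.
Proof. by rewrite invr_gt0 mulr_gt0. Qed.

Lemma mul_eta_lt c : (c <= #|T|.+1)%N -> c%:R * eta < 2^-1.
Proof.
move=> cT; rewrite /eta invfM mulrCA -[ltRHS]mulr1 ltr_pM2l ?invr_gt0 //.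
by rewrite ltr_pdivrMr ?mul1r ?ltr_nat.
Qed.

Lemma floor_bounds (r : R) : (Num.floor r)%:~R <= r < (Num.floor r)%:~R + 1.
Proof. by have := floor_itv r; rewrite intrD. Qed.

Lemma rnd_eq (r : R) (k : int) : `|r - k%:~R| < 2^-1 -> rnd r = k.
Proof.
rewrite ltr_norml => /andP[h1 h2]; apply: floor_def.
rewrite intrD; apply/andP; split; lra.
Qed.

Lemma nearset_mono c c' y : (c <= c')%N -> nearset c y \subset nearset c' y.
Proof.
move=> cc'; apply/fintype.subsetP => l; rewrite !inE => /le_trans; apply.
by rewrite ler_pM2r ?eta_gt0 // ler_nat.
Qed.

Lemma nearset_gap y : nearset (colour y).+1 y \subset nearset (colour y) y.
Proof.
rewrite /colour; case: arg_maxnP => //= c hc cmax.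
have [cT|cT] := ltnP c #|T|.
  have c1T : (c.+1 < #|T|.+1)%N by [].
  (* Otherwise [c.+1] would qualify as the colour, against maximality. *)
  have : (#|nearset c.+1 y| <= c)%N.
    rewrite leqNgt; apply/negP => /(cmax (Ordinal c1T)) /=; by rewrite /= ltnn.
  move=> hle; rewrite (_ : nearset c y = nearset c.+1 y) //.
  apply/eqP; rewrite eqEcard nearset_mono // (leq_trans hle) //.
suff -> : nearset c y = finset.setT by exact: finset.subsetT.
by apply/eqP; rewrite eqEcard finset.subsetT cardsT (leq_trans cT).
Qed.

(** A move by less than [eta] costs one threshold, and the new threshold is still below one half. *)
Lemma nearset_step c y y' l : (c <= #|T|)%N -> `|y l - y' l| < eta ->
  l \in nearset c y -> (l \in nearset c.+1 y') && (rnd (y' l) == rnd (y l)).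
Proof.
move=> cT yy'; rewrite !inE => hl.
have h : `|y' l - (rnd (y l))%:~R| <= c.+1%:R * eta.
  rewrite -natr1 mulrDl mul1r (_ : _ - _ = (y l - (rnd (y l))%:~R) - (y l - y' l)); last by ring.
  by rewrite (le_trans (ler_normB _ _)) // lerD // ltW.
have r : rnd (y' l) = rnd (y l) by apply: rnd_eq; rewrite (le_lt_trans h) // mul_eta_lt.
by rewrite r h eqxx.
Qed.

(** The floor of [y' l] is an integer lying between [y l] and [y' l]. *)
Lemma floor_near y y' l : `|y l - y' l| < eta -> Num.floor (y l) < Num.floor (y' l) ->
  l \in nearset 1 y'.
Proof.
move=> yy' ff; rewrite inE mul1r; set k := Num.floor (y' l).
have h : `|y' l - k%:~R| < eta.
  have := floor_bounds (y l); have := floor_bounds (y' l); rewrite -/k.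
  have : (Num.floor (y l))%:~R + 1 <= k%:~R :> R by rewrite -(intrD _ _ 1) ler_int; lia.
  move: yy'; rewrite ltr_norml => /andP[? ?] ? /andP[? ?] /andP[? ?].
  by rewrite ger0_norm; lra.
by rewrite (@rnd_eq _ k) ?ltW // (lt_trans h) //; have := @mul_eta_lt 1 isT; rewrite mul1r.
Qed.

(** Pieces of one colour are uniformly separated: a coordinate near for [y] is near for [y'] one
    threshold higher, hence near by [nearset_gap]; for the other coordinates a change of floor would
    create nearness. *)
Lemma key_close y y' : (forall l, `|y l - y' l| < eta) -> colour y = colour y' ->
  key y =1 key y'.
Proof.
have near_imp z z' l : (forall l, `|z l - z' l| < eta) -> colour z = colour z' ->
    l \in nearset (colour z) z -> (l \in nearset (colour z') z') && (rnd (z' l) == rnd (z l)).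
  move=> zz' cc hl; have cT : (colour z <= #|T|)%N by rewrite -ltnS ltn_ord.
  have /andP[h ->] := nearset_step cT (zz' l) hl.
  by rewrite cc in h; rewrite (fintype.subsetP (nearset_gap z') _ h).
have floor_imp z z' l : (forall l, `|z l - z' l| < eta) ->
    l \notin nearset (colour z') z' -> Num.floor (z' l) <= Num.floor (z l).
  move=> zz' hl; rewrite leNgt; apply: contra hl => /(floor_near (zz' l)) h.
  by apply: (fintype.subsetP (nearset_gap z')); apply: (fintype.subsetP (nearset_mono _ _) _ h).
move=> yy' cc l; have y'y k : `|y' k - y k| < eta by rewrite distrC.
rewrite /key; case: ifPn => [/(near_imp _ _ _ yy' cc)/andP[-> /eqP ->] //|nl].
case: ifPn => [/(near_imp _ _ _ y'y (esym cc))/andP[h _]|nl']; first by rewrite h in nl.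
by congr pair; apply/le_anti; rewrite (floor_imp _ _ _ y'y) // (floor_imp _ _ _ yy').
Qed.

(** A pinned coordinate is less than one half from the common integer and any other one shares its
    floor, so pieces are small. *)
Lemma key_dist y y' l : key y l = key y' l -> `|y l - y' l| < 1.
Proof.
rewrite /key; case: ifPn => hl; case: ifPn => hl' // [].
  move: hl hl'; rewrite !inE => hl hl' rr; rewrite -rr in hl'.
  have := mul_eta_lt (ltnW (ltn_ord (colour y))); have := mul_eta_lt (ltnW (ltn_ord (colour y'))).
  move: hl hl'; rewrite !ler_norml ltr_norml => /andP[? ?] /andP[? ?] ? ?.
  by apply/andP; split; lra.
move=> ff; have := floor_bounds (y l); have := floor_bounds (y' l); rewrite ff.
by move=> /andP[? ?] /andP[? ?]; rewrite ltr_norml; apply/andP; split; lra.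
Qed.

(* Were the conclusion false, the pieces of the colour classes would separate,
   for each colour [i < D], the faces [z i = 0] and [z i = n] of the grid. *)
Lemma grid_no_separation (D n : nat) (G : (nat -> nat) -> T -> R) :
  (#|T| < D)%N -> (0 < n)%N ->
  (forall z w, (forall i, (i < D)%N -> (z i <= n)%N /\ (w i <= n)%N /\ (`|z i - w i| <= 2)%N) ->
    forall l, `|G z l - G w l| < eta) ->
  exists z w i, [/\ (i < D)%N,
    forall j, (j < D)%N -> (z j <= n)%N /\ (w j <= n)%N,
    (z i <= 1)%N, (n <= w i + 1)%N & forall l, `|G z l - G w l| < 1].
Proof.
move=> TD n0 Gclose; apply: contrapT => nex.
pose grid (z : nat -> nat) := forall j, (j < D)%N -> (z j <= n)%N.
pose same z w i := [/\ colour (G z) = i :> nat, colour (G w) = i :> nat & key (G z) =1 key (G w)].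
(* By [key_dist], two points of one piece near opposite faces would witness the denied
   conclusion. *)
have far z w i : (i < D)%N -> grid z -> grid w -> same z w i -> (z i <= 1)%N -> (w i + 1 < n)%N.
  move=> iD gz gw [_ _ kzw] zi; rewrite ltnNge; apply/negP => wi; apply: nex.
  exists z, w, i; split=> // [j jD|l]; first by split; [exact: gz|exact: gw].
  exact: key_dist.
(* [a i] vanishes near the pieces of colour [i] that touch the low [i]-th face. *)
pose low i y := exists w z, [/\ grid w, grid z,
  forall j, (j < D)%N -> (`|w j - y j| <= 1)%N, same w z i & (z i <= 1)%N].
pose a i y := (y i != 0%N) && ((y i == n) || ~~ `[< low i y >]).
have [i y iD yi|i y iD yi|x xn xP] := @discrete_miranda n D a.
- by rewrite /a yi.
- by rewrite /a yi eqxx -lt0n n0.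
(* The contradiction arises in the direction numbered by the colour of the cell's own corner [x]:
   there [a c] takes a single value on the whole cell. *)
pose c : nat := colour (G x).
have cD : (c < D)%N by rewrite (leq_ltn_trans _ TD) // -ltnS ltn_ord.
have gx : grid x by move=> j jD; exact/ltnW/xn.
have {xP}[y [z [hy hz]]] := xP c cD.
pose lowx := exists z, [/\ grid z, same x z c & (z c <= 1)%N].
suff aE y' : (forall j, (x j <= y' j <= (x j).+1)%N) -> a c y' = ~~ `[< lowx >].
  by rewrite (aE y) // (aE z) // eqxx.
move=> {y z hy hz}hy.
have [[z [gz [cx cz kxz] zc]]|nlow] := asboolP lowx.
  rewrite /a; case: eqVneq => //= _; apply/negbTE; rewrite negb_or negbK.
  apply/andP; split.
    have : (x c + 1 < n)%N by apply: (@far z) => //; split=> // l; rewrite kxz.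
    by move: (hy c); lia.
  by apply/asboolP; exists x, z; split=> // j jD; move: (hy j); lia.
rewrite /a; apply/andP; split.
  apply: contra_notN nlow => /eqP yc; exists x; split=> //.
  by move: (hy c); lia.
apply/orP; right; apply/asboolPn => -[w [z [gw gz wy [cw cz kwz] zc]]].
apply: nlow; exists z; split=> //; split=> // l.
rewrite -kwz; apply: key_close => [k|]; last by apply: val_inj; rewrite /= cw.
(* [w] is within 1 of a corner of the cell, hence within 2 of [x]. *)
apply: Gclose => j jD; split; [exact: gx|split; [exact: gw|]].
by move: (hy j) (wy j jD); lia.
Qed.
End Colouring.

(** * Non-existence of continuous injections that lower the dimension *)

Local Open Scope classical_set_scope.

(** Near each point of [K] either [g < e] or [f] exceeds a positive constant; compactness makes the
    threshold uniform. It serves below both as uniform continuity and as uniform injectivity. *)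
Lemma compact_modulus (R : realType) (X : topologicalType) (K : set X) (f g : X -> R) :
  compact K -> (forall p, K p -> {for p, continuous f}) ->
  (forall p, K p -> {for p, continuous g}) ->
  (forall p, K p -> f p <= 0 -> g p <= 0) ->
  forall e, 0 < e -> exists2 d, 0 < d & forall p, K p -> f p < d -> g p < e.
Proof.
move=> /compact_near_coveringP cK fc gc fg e e0.
have H : \forall d \near (0:R)^'+, K `<=` (fun p => f p < d -> g p < e).
  apply: (cK R (0^'+) (fun d p => f p < d -> g p < e)) => p Kp.
  have [fp|fp] := leP (f p) 0.
    have gp : \forall p' \near p, g p' < e.
      by apply: cvgr_lt (gc _ Kp) _ _; exact: le_lt_trans (fg _ Kp fp) e0.
    by near=> p' d => _ /=; near: p'.
  have fp2 : f p / 2 < f p by rewrite ltr_pdivrMr // ltr_pMr // ltr1n.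
  have fp' : \forall p' \near p, f p / 2 < f p' by apply: cvgr_gt (fc _ Kp) _ _.
  near=> p' d => /= fd; exfalso.
  have h1 : f p / 2 < f p' by near: p'.
  have h2 : d < f p / 2 by near: d; apply: nbhs_right_lt; rewrite divr_gt0.
  by have := lt_trans h2 (lt_trans h1 fd); rewrite ltxx.
have [d [d0 dP]] := filter_ex (filterI (nbhs_right_gt 0) H).
by exists d.
Unshelve. all: by end_near.
Qed.

Lemma rV_dist_lt (R : realType) D (x y : 'rV[R]_D) e : 0 < e ->
  (`|x - y| < e) <-> forall i, `|x ord0 i - y ord0 i| < e.
Proof.
move=> e0; have -> : (`|x - y| < e) = ball x e y :> Prop by rewrite mx_norm_ball.
split=> [[_ h] i|h]; first exact: h.
by split=> // i j; rewrite (ord1 i); exact: h.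
Qed.

Lemma no_continuous_injection (R : realType) (D : nat) (T : finType)
    (F : T -> 'rV[R]_D -> R) (U : set 'rV[R]_D) :
  (#|T| < D)%N -> open U -> U !=set0 ->
  (forall t x, U x -> {for x, continuous (F t)}) ->
  exists x y, [/\ U x, U y, x != y & forall t, F t x = F t y].
Proof.
move=> TD oU [c Uc] Fc; apply: contrapT => ninj.
have [e /= e0 ceU] : exists2 e : R, 0 < e & ball c e `<=` U.
  by have /nbhs_ballP := open_nbhs_nbhs (conj oU Uc).
pose rho := e / 2; have rho0 : 0 < rho by rewrite divr_gt0.
pose C := [set v : 'rV[R]_D | forall i, `[c ord0 i, c ord0 i + rho]%classic (v ord0 i)].
have cC : compact C.
  apply: (@rV_compact R D (fun i => `[c ord0 i, c ord0 i + rho]%classic)) => i.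
  exact: segment_compact.
have CU : C `<=` U.
  move=> v Cv; apply: ceU; split=> // i j; rewrite (ord1 i) /ball /= distrC.
  by have := Cv j; rewrite /= in_itv /= /rho => /andP[? ?]; rewrite ger0_norm; lra.
pose Phi (p : 'rV[R]_D * 'rV[R]_D) := \sum_t `|F t p.1 - F t p.2|.
pose N (p : 'rV[R]_D * 'rV[R]_D) : R := `|p.1 - p.2|.
have cCC : compact (C `*` C) by exact: compact_setX.
have Fst p : {for p, continuous (fun q : 'rV[R]_D * 'rV[R]_D => q.1)} by exact: cvg_fst.
have Snd p : {for p, continuous (fun q : 'rV[R]_D * 'rV[R]_D => q.2)} by exact: cvg_snd.
have Phic p : (C `*` C) p -> {for p, continuous Phi}.
  move=> [Cx Cy]; apply: cvg_big => [|t _]; first exact: add_continuous.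
  apply: cvg_norm; apply: cvgB.
    by apply: (continuous_comp (Fst p)); exact/Fc/CU.
  by apply: (continuous_comp (Snd p)); exact/Fc/CU.
have Nc p : (C `*` C) p -> {for p, continuous N}.
  by move=> _; apply: cvg_norm; apply: cvgB; [exact: Fst|exact: Snd].
have Phi_coord x y t : `|F t x - F t y| <= Phi (x, y).
  by rewrite /Phi (bigD1 t) //= lerDl sumr_ge0.
have rho2 : 0 < rho / 2 by rewrite divr_gt0.
(* Uniform injectivity: nearly equal values force points closer than half the side of the cube. *)
have [|d1 d10 d1P] := compact_modulus cCC Phic Nc _ rho2.
  move=> [x y] [/= Cx Cy] Phi0; have /eqP-> : x == y; last by rewrite /N subrr normr0.
  apply/negP => /negP xy; apply: ninj; exists x, y; split; [exact: CU|exact: CU|by []|].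
  move=> t; apply/eqP; rewrite -subr_eq0 -normr_le0.
  exact: le_trans (Phi_coord _ _ _) Phi0.
(* After division by [s], values of [G] within 1 keep [Phi], a sum of [#|T|] terms, below [d1]. *)
pose s : R := d1 / #|T|.+1%:R.
have s0 : 0 < s by rewrite divr_gt0.
have eta0 := eta_gt0 R T.
have [|d2 d20 d2P] := compact_modulus cCC Nc Phic _ (mulr_gt0 eta0 s0).
  move=> [x y] _; rewrite /N /= normr_le0 subr_eq0 => /eqP ->.
  by rewrite /Phi big1 // => t _; rewrite subrr normr0.
(* The bound by [d2] makes grid points at most 2 steps apart [d2]-close; [4 <= n] makes [n - 2] at
   least [n / 2] in the final contradiction. *)
have [n n4 nd2] : exists2 n : nat, (4 <= n)%N & 2 * rho / d2 < n%:R.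
  exists (4 + (Num.bound (2 * rho / d2)))%N; first exact: leq_addr.
  rewrite (lt_le_trans (archi_boundP _)) ?ler_nat ?leq_addl // divr_ge0 ?mulr_ge0 ?ltW //.
have n0 : 0 < n%:R :> R by rewrite ltr0n; lia.
pose pt (z : nat -> nat) : 'rV[R]_D := \row_(i < D) (c ord0 i + rho * (z i)%:R / n%:R).
have ptC z : (forall i, (i < D)%N -> (z i <= n)%N) -> C (pt z).
  move=> zn i; rewrite /= mxE in_itv /= lerDl lerD2l -mulrA; apply/andP; split.
    by rewrite mulr_ge0 ?divr_ge0 // ltW.
  by rewrite ler_piMr ?(ltW rho0) // ler_pdivrMr // mul1r ler_nat zn.
have pt_dist z w i : `|pt z ord0 i - pt w ord0 i| = rho / n%:R * `|(z i)%:R - (w i)%:R|.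
  rewrite !mxE (_ : _ - _ = rho / n%:R * ((z i)%:R - (w i)%:R)); last by ring.
  by rewrite normrM gtr0_norm // divr_gt0.
pose G z t := F t (pt z) / s.
have GE z w t : `|G z t - G w t| = `|F t (pt z) - F t (pt w)| / s.
  by rewrite -mulrBl normrM [`|s^-1|]gtr0_norm ?invr_gt0.
have [|| z [w [i [iD zw zi wi hG]]]] := @grid_no_separation R T D n G TD.
- by lia.
- move=> z w zw t; rewrite GE ltr_pdivrMr //.
  apply: le_lt_trans (Phi_coord _ _ _) _; apply: d2P.
    by split; apply: ptC => i /zw[? []].
  apply/(rV_dist_lt _ _ d20) => i; rewrite pt_dist.
  have [_ [_ zw2]] := zw i (ltn_ord i).
  apply: (@le_lt_trans _ _ (rho / n%:R * 2)).
    rewrite ler_wpM2l // ?(divr_ge0 (ltW rho0) (ltW n0)) //.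
    have [h1 h2] : (z i <= w i + 2 /\ w i <= z i + 2)%N by lia.
    move: h1 h2; rewrite -!(ler_nat R) !natrD => h1 h2.
    by rewrite ler_norml; apply/andP; split; lra.
  by rewrite mulrAC ltr_pdivrMr // mulrC [d2 * _]mulrC -ltr_pdivrMr.
have CC : (C `*` C) (pt z, pt w) by split; apply: ptC => j /zw[].
have /(rV_dist_lt _ _ rho2) /(_ (Ordinal iD)) : `|pt z - pt w| < rho / 2.
  apply: (d1P _ CC); rewrite /Phi /=.
  apply: (@le_lt_trans _ _ (\sum_(t : T) s)).
    apply: ler_sum => t _; have := hG t; rewrite GE ltr_pdivrMr // mul1r; exact: ltW.
  rewrite sumr_const -mulr_natr /s -mulrA gtr_pMr //.
  by rewrite mulrC ltr_pdivrMr ?mul1r ?ltr_nat.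
rewrite pt_dist /= -mulrA ltr_pM2l // mulrC ltr_pdivrMr //.
have h : (z i + n <= w i + 2)%N by lia.
move: h n4; rewrite -!(ler_nat R) !natrD => h n4.
by rewrite ltr_norml => /andP[? ?]; lra.
Qed.

(** * Quantized probabilities *)

Lemma open_setD_finite (R : realType) (D : nat) (U A : set 'rV[R]_D) :
  open U -> finite_set A -> open (U `\` A).
Proof.
move=> oU finA; rewrite setDE; apply: openI => //; apply: closed_openC.
have /accessible_finite_set_closed cl : accessible_space 'rV[R]_D.
  exact/hausdorff_accessible/norm_hausdorff.
exact: cl.
Qed.

(** In a finite open set singletons are open; on an open singleton the empty family of functions
    would have to identify two distinct points. *)
Lemma open_rV_infinite (R : realType) (D : nat) (U : set 'rV[R]_D) :
  (0 < D)%N -> open U -> U !=set0 -> infinite_set U.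
Proof.
move=> D0 oU [p Up] finU.
have op : open [set p].
  rewrite (_ : [set p] = U `\` (U `\ p)).
    by apply: open_setD_finite => //; exact: finite_setD.
  apply/seteqP; split=> [x ->|x [Ux /not_andP[//|/contrapT]]] //.
  by split=> // -[_ /(_ erefl)].
have [||||x [y [-> -> /eqP]]] := @no_continuous_injection R D void (fun t _ => 0) [set p] => //.
- by rewrite card_void.
- by exists p.
Qed.

Lemma is_derive_sum_seq (R : numFieldType) (V W : normedModType R) (I : Type) (r : seq I)
    (h : I -> V -> W) (x v : V) :
  (forall i, derivable (h i) x v) ->
  is_derive x v (fun t => \sum_(i <- r) h i t) (\sum_(i <- r) 'D_v (h i) x).
Proof.
move=> dh; elim: r => [|i r IH].
  rewrite big_nil (_ : (fun t => _) = cst 0); first exact: is_derive_cst.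
  by apply/funext => t; rewrite big_nil.
rewrite big_cons (_ : (fun t => _) = h i + (fun t => \sum_(i <- r) h i t)).
  by apply: is_deriveD; exact/derivableP.
by apply/funext => t; rewrite big_cons.
Qed.

Lemma derive_sum_const (R : numFieldType) (V W : normedModType R) (I : finType)
    (h : I -> V -> W) (w : W) (x v : V) :
  (forall i, derivable (h i) x v) -> (forall t, \sum_i h i t = w) ->
  \sum_i 'D_v (h i) x = 0.
Proof.
move=> dh hw; have := @derive_val _ _ _ _ _ _ _ (is_derive_sum_seq (index_enum I) dh).
by move=> <-; rewrite (_ : (fun t => _) = cst w) ?derive_cst //; exact/funext.
Qed.

(** A matrix with more rows than columns has a nonzero left kernel. *)
Lemma common_orthogonal_vector (F : fieldType) (D : nat) (T : finType) (g : T -> 'rV[F]_D) :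
  (#|T| < D)%N -> exists2 v : 'rV[F]_D, v != 0 & forall t, v *m (g t)^T = 0.
Proof.
move=> TD; pose M := \matrix_(i < D, t < #|T|) g (enum_val t) ord0 i.
have : kermx M != 0.
  rewrite kermx_eq0 /row_free neq_ltn (leq_ltn_trans (rank_leq_col _) TD) //.
case/rowV0Pn => v /sub_kermxP vM v0; exists v => // t.
apply/matrixP => i j; rewrite !ord1; have := congr1 (fun A : 'rV_#|T| => A ord0 (enum_rank t)) vM.
rewrite !mxE => vM0; rewrite -[RHS]vM0; apply: eq_bigr => k _; by rewrite !mxE enum_rankK.
Qed.

(** * Number and total probability of the outcomes of a superquantizer *)

Section Quantizer.
Variables (R : realType) (D P K : nat) (grpOf : 'I_K -> 'I_P).
Variables (L : 'I_K -> nat) (Rq : forall k, 'I_(L k) -> nat).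
Variables (d : 'I_P -> measure_display) (X : forall p, measurableType (d p)).
Variable (Pm : forall p, 'rV[R]_D -> probability (X p) R).
Variable (gam : forall k (l : 'I_(L k)), X (grpOf k) -> 'I_(@Rq k l)).

(** A space carrying a probability law is nonempty, and any point of it yields an outcome. *)
Lemma outcome_inhabited k : exists s : outcome Rq k, True.
Proof.
have /set0P[x _] : [set: X (grpOf k)] != set0.
  apply/eqP => X0; have := probability_setT (Pm (grpOf k) 0).
  by rewrite X0 measure0 => /eqP; rewrite lt_eqF.
by exists (superq gam x).
Qed.

Lemma card_outcome k : #|outcome Rq k| = (\prod_(l < L k) @Rq k l)%N.
Proof.
rewrite card_dep_ffun foldrE big_map big_enum /=.
by apply: eq_bigr => l _; rewrite card_ord.
Qed.

Hypothesis measurable_gam : forall k (l : 'I_(L k)) (r : 'I_(@Rq k l)),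
  measurable [set x | @gam k l x = r].

Lemma measurable_superq k (s : outcome Rq k) : measurable [set x | superq gam x = s].
Proof.
rewrite (_ : [set x | _] = \bigcap_(l in [set: 'I_(L k)]) [set x | @gam k l x = s l]).
  by apply: fin_bigcap_measurable => [|l _]; [exact: finite_finset|exact: measurable_gam].
apply/seteqP; split=> [x <- l _ /=|x h]; first by rewrite /superq ffunE.
by apply/ffunP => l; rewrite ffunE; exact: h.
Qed.

Lemma qprob_sum k th : \sum_(s : outcome Rq k) qprob Pm gam s th = 1.
Proof.
rewrite /qprob sum_fine => [|s _]; last by apply: fin_num_measure; exact: measurable_superq.
rewrite fsbig_seq ?index_enum_uniq // -measure_fin_bigcup.
- rewrite (_ : \bigcup_(s in _) [set x | superq gam x = s] = setT).
    exact: (congr1 fine (probability_setT (Pm (grpOf k) th))).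
  by apply/seteqP; split=> // x _; exists (superq gam x); rewrite //= mem_index_enum.
- exact: finite_finset.
- by move=> s t _ _ [x [/= -> ->]].
- by move=> s _; exact: measurable_superq.
Qed.
End Quantizer.

(** * Singular Fisher matrix and nonidentifiable parameters *)

Theorem theorem3 (R : realType) (D N P K : nat)
  (grpOf : 'I_K -> 'I_P) (sg : 'I_N -> 'I_K)
  (L : 'I_K -> nat) (Rq : forall k, 'I_(L k) -> nat)
  (d : 'I_P -> measure_display) (X : forall p, measurableType (d p))
  (Pm : forall p, 'rV[R]_D -> probability (X p) R)
  (gam : forall k (l : 'I_(L k)), X (grpOf k) -> 'I_(@Rq k l))
  (Theta : set 'rV[R]_D) :
  (* identical-models assumption: P < N groups, each split into nonempty subgroups *)
  (P < N)%N ->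
  (forall p : 'I_P, exists k : 'I_K, grpOf k = p) ->
  (forall k : 'I_K, exists j : 'I_N, sg j = k) ->
  (* component quantizers are measurable, so the quantization regions are events *)
  (forall k (l : 'I_(L k)) (r : 'I_(@Rq k l)),
      measurable [set x | @gam k l x = r]) ->
  interior Theta !=set0 ->
  (D > lambda_ISM Rq)%N ->
  (* (i) *)
  ((forall (j : 'I_N) (s : outcome Rq (sg j)) (th : 'rV[R]_D), Theta th ->
       differentiable (qsens Pm gam s) th /\
       forall a : 'I_D,
         differentiable (fun t => derive (qsens Pm gam s) t (ebasis R a)) th) ->
   forall th : 'rV[R]_D, Theta th -> \det (FIM sg Pm gam th) = 0)
  /\
  (* (ii) *)
  ((forall (j : 'I_N) (s : outcome Rq (sg j)),
       {within Theta, continuous (qsens Pm gam s)}) ->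
   ~ identifiable sg Pm gam Theta /\
   forall U : set 'rV[R]_D, open U -> U `<=` Theta -> U !=set0 ->
     infinite_set [set th | U th /\ ~ identifiable_pt sg Pm gam Theta th]).
Proof.
move=> _ _ sg_surj mgam Theta0 Dlam.
pose q k (s : outcome Rq k) := qprob Pm gam s.
have qsum k th : \sum_s q k s th = 1 by exact: qprob_sum.
(* [s0 k] is the outcome dropped in subgroup [k]; [T] below indexes the others, [lambda_ISM] in
   number. *)
have /cid[s0 _] : exists s0 : forall k, outcome Rq k, True.
  have h k := outcome_inhabited Pm gam k.
  by exists (fun k => proj1_sig (cid (h k))).
pose T : finType := {k : 'I_K & {s : outcome Rq k | s != s0 k}}.
have TD : (#|T| < D)%N.
  apply: leq_ltn_trans Dlam; rewrite card_tagged sumnE big_map big_enum /=.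
  apply: leq_sum => k _; rewrite card_sig -(card_outcome Rq k) subn1.
  by rewrite -(cardC1 (s0 k)) eq_leq //; apply: eq_card => s; rewrite !inE.
pose qT (t : T) := q (tag t) (val (tagged t)).
split=> [dq th Thth|cq].
  have dqk k (s : outcome Rq k) : differentiable (q k s) th.
    by have [j jk] := sg_surj k; subst k; have [] := dq j s th Thth.
  have [v v0 vT] := common_orthogonal_vector (fun t => grad (qT t) th) TD.
  apply/eqP/det0P; exists v => //.
  have vq k s : v *m (grad (q k s) th)^T = 0.
    have vq' s' : s' != s0 k -> v *m (grad (q k s') th)^T = 0.
      by move=> s'0; exact: (vT (Tagged _ (exist _ s' s'0) : T)).
    have [->|/vq' //] := eqVneq s (s0 k).
    (* The gradients within a subgroup sum to zero, so the dropped one is minus a sum of gradients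
       orthogonal to [v]. *)
    have : \sum_s (grad (q k s) th) = 0.
      apply/rowP => a; rewrite summxE mxE.
      rewrite -[RHS](@derive_sum_const R _ R^o _ (q k) 1 th (ebasis R a)) //.
        by apply: eq_bigr => s' _; rewrite mxE.
      by move=> s'; exact: diff_derivable.
    move=> /(congr1 (fun g => v *m g^T)); rewrite trmx0 mulmx0 raddf_sum mulmx_sumr.
    by rewrite (bigD1 (s0 k)) //= big1 ?addr0 // => s' /vq'.
  rewrite /FIM mulmx_sumr big1 // => j _; rewrite mulmx_sumr big1 // => s _.
  by rewrite -scalemxAr mulmxA vq mul0mx scaler0.
have equivT th th' : (forall t, qT t th = qT t th') -> obs_equiv sg Pm gam th th'.
  move=> eqT u; apply: eq_bigr => j _; rewrite /qsens.
  move: (sg j) (u j) => k s {u j}.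
  have qs' s' : s' != s0 k -> q k s' th = q k s' th'.
    by move=> s'0; exact: (eqT (Tagged _ (exist _ s' s'0) : T)).
  have [->|/qs' //] := eqVneq s (s0 k).
  (* The dropped probability is 1 minus the sum of the others. *)
  have := qsum k th; rewrite -(qsum k th') (bigD1 (s0 k)) //= [in RHS](bigD1 (s0 k)) //=.
  by rewrite (eq_bigr _ qs') => /addIr.
have D0 : (0 < D)%N by exact: leq_ltn_trans Dlam.
have H U : open U -> U `<=` Theta -> U !=set0 ->
     infinite_set [set th | U th /\ ~ identifiable_pt sg Pm gam Theta th].
  (* If [A] were finite, [U] minus [A] would be open and nonempty; a collision of [qT] inside it
     gives a nonidentifiable point of [U] outside [A]. *)
  move=> oU UT U0; set A := [set th | _] => finA.
  have oUA : open (U `\` A) by exact: open_setD_finite.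
  have [th [Uth nAth]] : U `\` A !=set0.
    apply/set0P/negP => /eqP UA0; apply: (open_rV_infinite D0 oU U0).
    by apply: sub_finite_set finA; rewrite -setD_eq0.
  have UAT : U `\` A `<=` Theta by move=> x [/UT].
  have [||x [y [[Ux nAx] [Uy _] xy eqT]]] := no_continuous_injection TD oUA (F := qT).
  - by exists th.
  - move=> t x Ux; have [j jk] := sg_surj (tag t).
    have cqt : {within Theta, continuous (qT t)}.
      by rewrite /qT; move: (val (tagged t)); rewrite -jk => s; exact: cq.
    have := continuous_subspaceW UAT cqt; rewrite continuous_open_subspace // => /(_ x).
    by apply; rewrite inE.
  - apply: nAx; split=> // /(_ y (UT _ Uy)); apply; first by apply/eqP; rewrite eq_sym.
    exact: equivT.
split=> // idT; have := H _ (@open_interior _ Theta) (@interior_subset _ Theta) Theta0.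
apply; rewrite (_ : [set th | _] = set0) //.
by apply/seteqP; split=> // th [Tth]; apply; exact: idT (interior_subset Tth).
Qed.
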